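(* Let Assumption B hold and let $\{\hat x_k\}$ be generated by IPR-VFISTA$_{nc}$ (see context). Assume that one of the following holds: (1) $\omega_h=\mathbb{I}_X$ (the indicator function of $X$), where $X\subset\mathbb{R}^n$ is a nonempty compact convex set, and $\{J_k\}$ is an increasing sequence of positive integers with $J_k\to\infty$. (2) $X^*_{\bar h}$ is bounded and $\alpha$-weakly sharp of order $2$, and $J_k:=\lceil(k+1)^a\rceil$ for all $k\ge0$, where $a\ge2$. Then $\liminf_{k\to\infty}\|G_{1/\hat\gamma}(\hat x_k)\|=0$.
   Context: Problem: minimize $f(x)$ over $x\in X^*_{\bar h}:=\arg\min_{x\in\mathbb{R}^n}\bar h(x)$, $\bar h:=h+\omega_h$, with $\bar h^*:=\inf\bar h$. Norms are Euclidean. Assumption B: (i) $f:\mathbb{R}^n\to\mathbb{R}$ is $L_f$-smooth, possibly nonconvex; (ii) $h:\mathbb{R}^n\to\mathbb{R}$ is convex and $L_h$-smooth; (iii) $\omega_h:\mathbb{R}^n\to(-\infty,\infty]$ is proper, closed, convex; (iv) $X^*_{\bar h}\ne\emptyset$; (v) $\inf_{x\in\mathbb{R}^n}f(x)>-\infty$. ($L_f,L_h>0$.) $X^*_{\bar h}$ is $\alpha$-weakly sharp of order $m$ if $\alpha>0$ and $\bar h(x)-\bar h^*\ge\alpha\,\mathrm{dist}^m(x,X^*_{\bar h})$ for all $x\in\mathbb{R}^n$. Residual mapping: $G_{1/\hat\gamma}(x):=\frac1{\hat\gamma}\left(x-\Pi_{X^*_{\bar h}}[x-\hat\gamma\nabla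 f(x)]\right)$, $\Pi$ denoting Euclidean projection; $\mathrm{prox}_{g}[x]:=\arg\min_u\{g(u)+\frac12\|u-x\|^2\}$. IPR-VFISTA$_{nc}$: inputs $\hat x_0$, $y_{0,0}=x_{0,0}\in\mathbb{R}^n$, outer stepsize $0<\hat\gamma\le\frac1{2L_f}$, an increasing sequence of positive integers $\{J_k\}$, $\bar\eta>0$, a nonempty compact set $\mathcal{B}\subseteq\mathrm{dom}(\omega_h)$ (with $\sup_{x\in\mathcal{B}}\bar h(x)<\infty$). For $k=0,1,2,\dots$: set $z_k=\hat x_k-\hat\gamma\nabla f(\hat x_k)$, $\eta_k:=16(L_h+\bar\eta)\left(\frac{\ln(J_k)}{J_k}\right)^2$, $\gamma_k:=\frac1{L_h+\eta_k}$, $\kappa_k:=\frac{L_h+\eta_k}{\eta_k}$; for $j=0,\dots,J_k-1$ set $x_{k,j+1}:=\mathrm{prox}_{\gamma_k\omega_h}[y_{k,j}-\gamma_k(\nabla h(y_{k,j})+\eta_k(y_{k,j}-z_k))]$, $y_{k,j+1}:=x_{k,j+1}+\frac{\sqrt{\kappa_k}-1}{\sqrt{\kappa_k}+1}(x_{k,j+1}-x_{k,j})$; then set $\hat x_{k+1}:=x_{k,J_k}$ and $y_{k+1,0}:=x_{k+1,0}:=\Pi_{\mathcal{B}}[x_{k,J_k}]$ (any nearest point of $\mathcal{B}$). If $J_k=1$ then $\eta_k=0$, $\kappa_k$ is undefined, but $y_{k,1}$ is never used. *)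

(* Defs.v *)
(* MathComp / MathComp-Analysis *)
From HB Require Import structures.
From mathcomp Require Import all_boot all_order all_algebra.
From mathcomp Require Import all_classical all_reals all_analysis.

Set Implicit Arguments.
Unset Strict Implicit.
Unset Printing Implicit Defensive.

Import Order.TTheory GRing.Theory Num.Theory.
Import numFieldNormedType.Exports.

Local Open Scope classical_set_scope.
Local Open Scope ring_scope.

Section Euclidean.
Context {R : realType} {n : nat}.
Local Notation V := 'rV[R]_n.

(* The library norm on 'rV[R]_n is the sup norm. It is used here only through
   notions that agree for all norms on R^n: topology, differentiability and
   boundedness. *)
Definition enorm (x : V) : R := Num.sqrt (\sum_(i < n) x ord0 i ^+ 2).

Definition dist (x : V) (A : set V) : R := inf [set enorm (x - u) | u in A].

Definition nearest (A : set V) (x : V) : set V :=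
  [set p | A p /\ forall u, A u -> enorm (x - p) <= enorm (x - u)].

(* The default value 0 is irrelevant when A is nonempty, closed and convex:
   nearest A x is then a singleton. *)
Definition proj (A : set V) (x : V) : V := xget 0 (nearest A x).

Definition grad (f : V -> R) (x : V) : V :=
  \row_(i < n) 'D_(delta_mx ord0 i) f x.

Definition smooth (L : R) (f : V -> R) : Prop :=
  (forall x, differentiable f x) /\
  (forall x y, enorm (grad f x - grad f y) <= L * enorm (x - y)).

End Euclidean.

Section ExtendedReal.
Context {R : realType} {n : nat}.
Local Notation V := 'rV[R]_n.
Implicit Types (g : V -> \bar R) (A : set V).
Local Open Scope ereal_scope.

Definition edom g : set V := [set x | g x < +oo].

Definition proper_fun g : Prop := (forall x, -oo < g x) /\ edom g !=set0.

Definition closed_fun g : Prop := closed [set p : V * R | g p.1 <= p.2%:E].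

Definition econvex_fun g : Prop :=
  forall (x y : V) (t : R), (0 <= t <= 1)%R ->
    g (t *: x + (1 - t) *: y)%R <= t%:E * g x + (1 - t)%:E * g y.

Definition eindic A : V -> \bar R := fun x => if `[< A x >] then 0 else +oo.

Definition argmin g : set V := [set x | forall u, g x <= g u].

(* Set-valued; a singleton when g is proper, closed and convex. *)
Definition prox g (x : V) : set V :=
  argmin (fun u => g u + (2^-1 * enorm (u - x) ^+ 2)%:E).

Definition weakly_sharp g (alpha : R) (m : nat) : Prop :=
  (0 < alpha)%R /\
  forall x, (alpha * dist x (argmin g) ^+ m)%:E <= g x - ereal_inf (range g).

End ExtendedReal.

Section Problem.
Context {R : realType} {n : nat}.
Local Notation V := 'rV[R]_n.

Definition hbar (h : V -> R) (omega : V -> \bar R) : V -> \bar R :=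
  fun x => ((h x)%:E + omega x)%E.

Record assumptionB (f : V -> R) (Lf : R) (h : V -> R) (Lh : R)
    (omega : V -> \bar R) : Prop := {
  aB_Lf_gt0 : 0 < Lf;
  aB_f_smooth : smooth Lf f;
  aB_Lh_gt0 : 0 < Lh;
  aB_h_convex : convex_function setT h;
  aB_h_smooth : smooth Lh h;
  aB_omega_proper : proper_fun omega;
  aB_omega_closed : closed_fun omega;
  aB_omega_convex : econvex_fun omega;
  aB_argmin_nonempty : argmin (hbar h omega) !=set0;
  aB_f_bounded_below : (-oo < ereal_inf (range (EFin \o f)))%E }.

(* residual gammah f S is G_{1/gammah}, for the solution set S. *)
Definition residual (gammah : R) (f : V -> R) (S : set V) (x : V) : V :=
  gammah^-1 *: (x - proj S (x - gammah *: grad f x)).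

Definition eta (Lh etab : R) (J : nat) : R :=
  16 * (Lh + etab) * (ln J%:R / J%:R) ^+ 2.

Definition gamma (Lh etab : R) (J : nat) : R := (Lh + eta Lh etab J)^-1.

(* For J = 1, eta is 0 and kappa takes the junk value 0; it then only enters
   the extrapolated point y k 1, which the algorithm never reads. *)
Definition kappa (Lh etab : R) (J : nat) : R :=
  (Lh + eta Lh etab J) / eta Lh etab J.

Definition momentum (Lh etab : R) (J : nat) : R :=
  (Num.sqrt (kappa Lh etab J) - 1) / (Num.sqrt (kappa Lh etab J) + 1).

Record ipr_vfista_input (Lf gammah : R) (J : nat -> nat) (etab : R)
    (h : V -> R) (omega : V -> \bar R) (B : set V) : Prop := {
  in_gammah : 0 < gammah <= (2 * Lf)^-1;
  in_J_gt0 : forall k, (0 < J k)%N;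
  in_J_incr : nondecreasing_seq J;
  in_etab : 0 < etab;
  in_B_nonempty : B !=set0;
  in_B_compact : compact B;
  in_B_dom : B `<=` edom omega;
  in_B_sup : (ereal_sup (hbar h omega @` B) < +oo)%E }.

(* The sequences xh k, x k j, y k j are generated by IPR-VFISTA_nc; the
   starting points xh 0 and x 0 0 are arbitrary. *)
Record ipr_vfista (f h : V -> R) (omega : V -> \bar R) (Lh gammah etab : R)
    (J : nat -> nat) (B : set V) (xh : nat -> V) (x y : nat -> nat -> V)
    : Prop := {
  run_init : y 0%N 0%N = x 0%N 0%N;
  run_prox : forall k j, (j < J k)%N ->
    let z := xh k - gammah *: grad f (xh k) in
    let et := eta Lh etab (J k) in
    let ga := gamma Lh etab (J k) in
    prox (fun u => ga%:E * omega u)%E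
      (y k j - ga *: (grad h (y k j) + et *: (y k j - z))) (x k j.+1);
  run_extrapolate : forall k j, (j < J k)%N ->
    y k j.+1 = x k j.+1 + momentum Lh etab (J k) *: (x k j.+1 - x k j);
  run_outer : forall k, xh k.+1 = x k (J k);
  run_restart : forall k, nearest B (x k (J k)) (x k.+1 0%N);
  run_restart_y : forall k, y k.+1 0%N = x k.+1 0%N }.

End Problem.

(* Main.v *)
Require Import Defs.
From mathcomp Require Import all_boot all_order all_algebra.
From mathcomp Require Import all_classical all_reals all_analysis.
From mathcomp Require Import ring lra.

Set Implicit Arguments.
Unset Strict Implicit.
Unset Printing Implicit Defensive.

Import Order.TTheory GRing.Theory Num.Theory.
Import numFieldNormedType.Exports.

Local Open Scope classical_set_scope.
Local Open Scope ring_scope.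

(* Write H for hbar, S for its argmin, z_k for the k-th gradient step and p_k
   for the projection of z_k on S. The geometric decay of the accelerated inner
   scheme holds against any comparison point, not only against the minimizer of
   the regularized objective. Comparing with p_k, and using that the choice of
   eta_k makes the contraction factor at most J_k^-4, gives
     H(xh_(k+1)) - min H + eta_k/2 |xh_(k+1) - z_k|^2
       <= eta_k/2 |p_k - z_k|^2 + C J_k^-4,
   where J_k^-4 = o(eta_k) and eta_k -> 0. Hence H(xh_(k+1)) -> min H, and
   xh_(k+1) is asymptotically no farther from z_k than p_k is; by compactness of
   bounded sublevel sets this forces xh_(k+1) - p_k -> 0 as soon as the iterates
   are bounded. Boundedness is trivial when the domain is compact; under weak
   sharpness of order 2 the same estimate gives
   |xh_(k+1) - s| <= |xh_k - s| / 2 + C for k large. The outer loop is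
   therefore a projected gradient method with vanishing errors, and a residual
   bounded away from 0 would make f decrease by a fixed amount at every step. *)

(** * Euclidean inner product and norm, compared with the sup norm *)

Section InnerProduct.
Context {R : realType} {n : nat}.
Local Notation V := 'rV[R]_n.
Implicit Types (x y z : V) (t : R).

Definition dotv x y : R := \sum_(i < n) x ord0 i * y ord0 i.

Lemma dotvC x y : dotv x y = dotv y x.
Proof. by apply: eq_bigr => i _; rewrite mulrC. Qed.

Lemma dotvDl x y z : dotv (x + y) z = dotv x z + dotv y z.
Proof. by rewrite -big_split; apply: eq_bigr => i _; rewrite mxE mulrDl. Qed.

Lemma dotvZl t x y : dotv (t *: x) y = t * dotv x y.
Proof. by rewrite mulr_sumr; apply: eq_bigr => i _; rewrite mxE mulrA. Qed.

Lemma dotvDr x y z : dotv x (y + z) = dotv x y + dotv x z.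
Proof. by rewrite dotvC dotvDl !(dotvC _ x). Qed.

Lemma dotvZr t x y : dotv x (t *: y) = t * dotv x y.
Proof. by rewrite dotvC dotvZl dotvC. Qed.

Lemma dotvNl x y : dotv (- x) y = - dotv x y.
Proof. by rewrite -scaleN1r dotvZl mulN1r. Qed.

Lemma dotvNr x y : dotv x (- y) = - dotv x y.
Proof. by rewrite dotvC dotvNl dotvC. Qed.

Definition dotvE := (dotvDl, dotvDr, dotvNl, dotvNr, dotvZl, dotvZr).

Lemma enorm2 x : enorm x ^+ 2 = dotv x x.
Proof.
rewrite /enorm sqr_sqrtr; first by apply: eq_bigr => i _; rewrite expr2.
by apply: sumr_ge0 => i _; exact: sqr_ge0.
Qed.

Lemma enorm_ge0 x : 0 <= enorm x.
Proof. exact: sqrtr_ge0. Qed.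

Lemma dotv_ge0 x : 0 <= dotv x x.
Proof. by rewrite -enorm2 sqr_ge0. Qed.

Lemma enormE x : enorm x = Num.sqrt (dotv x x).
Proof. by rewrite -enorm2 sqrtr_sqr ger0_norm// enorm_ge0. Qed.

Lemma enorm_eq0 x : enorm x = 0 -> x = 0.
Proof.
move=> x0; have : dotv x x = 0 by rewrite -enorm2 x0 expr0n.
move/eqP; rewrite psumr_eq0 => [/allP xi|i _]; last by rewrite -expr2 sqr_ge0.
apply/rowP => i; rewrite mxE; apply/eqP.
by have := xi i (mem_index_enum _); rewrite /= mulf_eq0 orbb.
Qed.

Lemma dotv_le_enorm x y : dotv x y <= enorm x * enorm y.
Proof.
have [/enorm_eq0->|x0] := eqVneq (enorm x) 0.
  by rewrite -(scale0r 0) dotvZl mul0r mulr_ge0 ?enorm_ge0.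
have [/enorm_eq0->|y0] := eqVneq (enorm y) 0.
  by rewrite -(scale0r 0) dotvZr mul0r mulr_ge0 ?enorm_ge0.
have xy0 : 0 < enorm x * enorm y by rewrite mulr_gt0// lt_def ?x0 ?y0 enorm_ge0.
(* Cauchy-Schwarz: expand this square, then divide by [enorm x * enorm y]. *)
have := dotv_ge0 (enorm x *: y - enorm y *: x).
rewrite !dotvE (dotvC y x) -!enorm2 => sq0.
by rewrite -(ler_pM2l xy0); lra.
Qed.

Lemma enormZ t x : enorm (t *: x) = `|t| * enorm x.
Proof.
rewrite !enormE !dotvE mulrA -expr2 sqrtrM ?sqr_ge0//.
by rewrite sqrtr_sqr.
Qed.

Lemma enormN x : enorm (- x) = enorm x.
Proof. by rewrite -scaleN1r enormZ normrN1 mul1r. Qed.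

Lemma enormB x y : enorm (x - y) = enorm (y - x).
Proof. by rewrite -enormN opprB. Qed.

Lemma ler_enormD x y : enorm (x + y) <= enorm x + enorm y.
Proof.
rewrite -(@ler_pXn2r _ 2) ?nnegrE ?addr_ge0 ?enorm_ge0//.
rewrite enorm2 !dotvE (dotvC y x) -!enorm2.
have := dotv_le_enorm x y; nra.
Qed.

Lemma ler_enorm_dist z x y : enorm (x - y) <= enorm (x - z) + enorm (z - y).
Proof. by rewrite -(subrKA z) ler_enormD. Qed.

Lemma mx_norm_le_enorm x : `|x| <= enorm x.
Proof.
rewrite [leLHS]/Num.norm /= mx_normrE; apply/bigmax_leP; split.
  exact: enorm_ge0.
move=> [i j] _ /=; rewrite ord1 -sqrtr_sqr; apply: ler_wsqrtr.
rewrite (bigD1 j)//= lerDl; apply: sumr_ge0 => k _; exact: sqr_ge0.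
Qed.

(** The factor [n] is cruder than its square root; only the equivalence of the two norms matters, to
    transfer continuity and boundedness. *)
Lemma enorm_le_mx_norm x : enorm x <= n%:R * `|x|.
Proof.
rewrite -(@ler_pXn2r _ 2) ?nnegrE ?mulr_ge0 ?enorm_ge0//.
rewrite enorm2 exprMn.
have H (i : 'I_n) : x ord0 i * x ord0 i <= `|x| ^+ 2.
  rewrite -expr2 -(@real_normK _ (x ord0 i)) ?num_real//.
  rewrite ler_pXn2r ?nnegrE//.
  rewrite [leRHS]/Num.norm /= mx_normrE.
  by apply/bigmax_geP; right; exists (ord0, i).
apply: le_trans (ler_sum _ (fun i _ => H i)) _.
rewrite sumr_const card_ord -[leLHS]mulr_natl.
rewrite ler_wpM2r ?sqr_ge0// -natrX ler_nat.
by case: (n) => // m; rewrite expnS leq_pmulr// expn_gt0.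
Qed.

Lemma enorm_continuous : continuous (enorm : V -> R).
Proof.
move=> x; apply/(@cvgrPdist_le R _ V (nbhs x) (nbhs_filter x)) => e e0.
have d0 : 0 < e / (n%:R + 1) by rewrite divr_gt0// ltr_wpDl.
apply/nbhs_ballP; exists (e / (n%:R + 1)) => // y.
rewrite -ball_normE /= => /ltW H.
have H2 : enorm (x - y) <= e.
  apply: le_trans (enorm_le_mx_norm _) _.
  apply: le_trans (_ : (n%:R + 1) * `|x - y| <= _).
    by rewrite ler_wpM2r// lerDl.
  by rewrite mulrC -ler_pdivlMr// ltr_wpDl.
rewrite ler_norml.
have := ler_enormD (x - y) y; rewrite subrK.
have := ler_enormD (y - x) x; rewrite subrK enormB.
move=> h1 h2; apply/andP; split; lra.
Qed.

Lemma enorm_bounded (A : set V) s M :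
  (forall x, A x -> enorm (x - s) <= M) -> bounded_set A.
Proof.
move=> AM; exists (M + enorm s); split; first exact: num_real.
move=> N MN x Ax; apply: le_trans (mx_norm_le_enorm x) _.
have := ler_enormD (x - s) s; rewrite subrK.
have := AM x Ax; move: MN; lra.
Qed.

Lemma bounded_enorm (A : set V) s : bounded_set A ->
  exists2 M, 0 <= M & forall x, A x -> enorm (x - s) <= M.
Proof.
move=> [M [_ AM]].
exists (n%:R * `|M + 1| + enorm s).
  by rewrite addr_ge0 ?enorm_ge0 ?mulr_ge0.
move=> x Ax; apply: le_trans (ler_enormD _ _) _.
rewrite enormN lerD2r; apply: le_trans (enorm_le_mx_norm _) _.
rewrite ler_wpM2l//; apply: le_trans (AM (M + 1) _ x Ax) (ler_norm _).
by rewrite ltrDl.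
Qed.

End InnerProduct.

(** The limit t -> 0 done by hand: at the chosen [t], the term [t * c] is at most half the supposed
    gap [a - b]. It turns minimality or convexity along a segment into a first-order condition. *)
Lemma le_of_small (R : realFieldType) (a b c : R) :
  (forall t, 0 < t <= 1 -> a <= b + t * c) -> a <= b.
Proof.
move=> H; rewrite leNgt; apply/negP => ba.
pose t := (a - b) / (2 * (a - b + `|c|)).
have d0 : 0 < a - b + `|c| by have := normr_ge0 c; lra.
have t0 : 0 < t by rewrite divr_gt0//; lra.
have tE : t * (a - b + `|c|) = (a - b) / 2 by rewrite /t; field; rewrite gt_eqF.
have t1 : t <= 1 by rewrite /t ler_pdivrMr; have := normr_ge0 c; lra.
have := H t; rewrite t0 t1 => /(_ isT).
have : t * c <= t * `|c| by rewrite ler_wpM2l ?ler_norm// ltW.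
nra.
Qed.

Lemma convex_functionT (R : realType) n (f : 'rV[R]_n -> R) :
  convex_function setT f -> forall x y t, 0 <= t <= 1 ->
  f (t *: x + (1 - t) *: y) <= t * f x + (1 - t) * f y.
Proof.
move=> fc x y t /andP[t0 t1].
by have := fc (Itv01 t0 t1) x y; rewrite !in_setT => /(_ isT isT).
Qed.

(** * First-order inequalities for smooth and for smooth convex functions *)

Section Smooth.
Context {R : realType} {n : nat}.
Local Notation V := 'rV[R]_n.
Variables (L : R) (f : V -> R).
Hypothesis fL : smooth L f.

Lemma derive_grad x d : 'D_d f x = dotv (grad f x) d.
Proof.
have fd := fL.1 x.
rewrite deriveE// [in LHS](row_sum_delta d) linear_sum /dotv.
by apply: eq_bigr => i _; rewrite linearZ /= mulrC mxE deriveE.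
Qed.

Lemma is_derive_line (x d : V) (t : R) :
  is_derive t (1 : R) (fun s : R => f (x + s *: d))
    (dotv (grad f (x + t *: d)) d).
Proof.
have E : (fun h : R => h^-1 *: (f (x + (h *: 1 + t) *: d) - f (x + t *: d))) =
  (fun h : R => h^-1 *: (f (h *: d + (x + t *: d)) - f (x + t *: d))).
  apply/funext => h; congr (_ *: (f _ - _)).
  by rewrite [h *: 1]mulr1 scalerDl addrCA.
have fd : derivable f (x + t *: d) d by exact: diff_derivable (fL.1 _).
apply: DeriveDef.
  by move: fd; rewrite /derivable /= -E.
by rewrite -derive_grad /derive /= -E.
Qed.

(** Descent lemma. The mean value theorem is applied to [f] along the segment minus its quadratic
    model [q]; the derivative of the difference is nonpositive by Cauchy-Schwarz and the Lipschitz
    gradient. *)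
Lemma smooth_upper x y :
  f y <= f x + dotv (grad f x) (y - x) + L / 2 * enorm (y - x) ^+ 2.
Proof.
set d := y - x.
pose g (t : R) := f (x + t *: d).
pose dg (t : R) := dotv (grad f (x + t *: d)) d.
pose q (t : R) := t * dotv (grad f x) d + t ^+ 2 * (L / 2 * enorm d ^+ 2).
pose dq (t : R) := dotv (grad f x) d + t * (L * enorm d ^+ 2).
have qd (t : R) : is_derive t (1 : R) q (dq t).
  apply: (@is_derive_eq _ _ _ _ _ _ _) => /=.
  by rewrite /dq /GRing.scale /=; field.
have gd (t : R) : is_derive t (1 : R) (g - q) (dg t - dq t).
  by apply: is_deriveB; exact: is_derive_line.
have gc : {within `[0, 1], continuous (g - q)}.
  apply: derivable_within_continuous => t _; exact: ex_derive.
have [c /= c01] :=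
  @MVT R (g - q) (fun t => dg t - dq t) 0 1 ltr01 (fun t _ => gd t) gc.
rewrite subr0 mulr1.
have -> : (g - q) 1 = f y - (dotv (grad f x) d + L / 2 * enorm d ^+ 2).
  by rewrite /g /q !fctE scale1r [x + d]addrC subrK expr1n !mul1r.
have -> : (g - q) 0 = f x.
  by rewrite /g /q !fctE scale0r addr0 expr0n !mul0r addr0 subr0.
move: c01; rewrite in_itv /= => /andP[c0 c1] H.
suff : dg c - dq c <= 0 by move: H; lra.
rewrite /dg /dq opprD addrA -dotvNl -dotvDl subr_le0.
apply: le_trans (dotv_le_enorm _ _) _.
have := fL.2 (x + c *: d) x.
rewrite addrAC subrr add0r enormZ gtr0_norm// => H1.
have := enorm_ge0 d; nra.
Qed.

(** Exchange the points in [smooth_upper] and move the gradient back from [y] to [x], which costs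
    another [L * enorm (y - x) ^+ 2]. The constant 3/2 is not sharp, but the term disappears in the
    limit taken in [convex_lower]. *)
Lemma smooth_lower x y :
  f x + dotv (grad f x) (y - x) - 3 * L / 2 * enorm (y - x) ^+ 2 <= f y.
Proof.
have := smooth_upper y x; rewrite (enormB x y).
have := dotv_le_enorm (grad f x - grad f y) (y - x).
have := fL.2 x y; rewrite (enormB x y).
have : dotv (grad f y) (x - y) = - dotv (grad f y) (y - x).
  by rewrite -dotvNr opprB.
rewrite dotvDl dotvNl; have := enorm_ge0 (y - x); nra.
Qed.

Lemma convex_lower : convex_function setT f -> forall x y,
  f x + dotv (grad f x) (y - x) <= f y.
Proof.
move=> /convex_functionT fc x y.
apply: (@le_of_small _ _ _ (3 * L / 2 * enorm (y - x) ^+ 2)) => t /andP[t0 t1].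
have := fc y x t; rewrite ltW// t1 => /(_ isT).
have := smooth_lower x (x + t *: (y - x)).
rewrite [x + _ - x]addrAC subrr add0r enormZ gtr0_norm// dotvZr.
have -> : x + t *: (y - x) = t *: y + (1 - t) *: x.
  by rewrite scalerBr scalerBl scale1r addrCA.
move=> H1 H2; rewrite -(ler_pM2l t0); lra.
Qed.

End Smooth.

(** * Accelerated proximal gradient on a strongly convex regularized objective *)

Section AcceleratedProximalGradient.
Context {R : realType} {n : nat}.
Local Notation V := 'rV[R]_n.
Variables (D : set V) (r : V -> R).

(** An extended-valued convex function is represented by its effective domain [D] and a real
    function [r] that is meaningful on [D]. *)
Definition convex_on : Prop := forall x y t, D x -> D y -> 0 <= t <= 1 ->
  D (t *: x + (1 - t) *: y) /\
  r (t *: x + (1 - t) *: y) <= t * r x + (1 - t) * r y.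

Definition is_prox (ga : R) (w p : V) : Prop := D p /\ forall u, D u ->
  ga * r p + 2^-1 * enorm (p - w) ^+ 2 <= ga * r u + 2^-1 * enorm (u - w) ^+ 2.

Hypothesis rc : convex_on.

(** Compare [p] with points of the segment from [p] to [u] and let them tend to [p]; the extra
    square is the strong convexity of the prox objective. *)
Lemma prox_three_point ga w p u : 0 <= ga -> is_prox ga w p -> D u ->
  ga * r p + 2^-1 * enorm (p - w) ^+ 2 + 2^-1 * enorm (u - p) ^+ 2
    <= ga * r u + 2^-1 * enorm (u - w) ^+ 2.
Proof.
move=> ga0 [Dp minp] Du.
apply: (@le_of_small _ _ _ (2^-1 * enorm (u - p) ^+ 2)) => t /andP[t0 t1].
have t01 : 0 <= t <= 1 by rewrite ltW.
have [Dt rt] := rc Du Dp t01.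
have := minp _ Dt.
have := ler_wpM2l ga0 rt.
have -> : t *: u + (1 - t) *: p - w = (p - w) + t *: (u - p).
  by apply/rowP => i; rewrite !mxE; ring.
have -> : u - w = (p - w) + (u - p) by rewrite [RHS]addrC subrKA.
move: (p - w) (u - p) => a b; rewrite !enorm2 !dotvE (dotvC b a) => H1 H2.
rewrite -(ler_pM2l t0); lra.
Qed.

Variables (h : V -> R) (Lh eta : R) (z : V).
Hypotheses (Lh0 : 0 < Lh) (eta0 : 0 < eta).
Hypotheses (hL : smooth Lh h) (hc : convex_function setT h).

Let Phi u : R := h u + r u + eta / 2 * enorm (u - z) ^+ 2.
Let ga := (Lh + eta)^-1.

Definition prox_grad (y p : V) : Prop :=
  is_prox ga (y - ga *: (grad h y + eta *: (y - z))) p.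

(** Only [h] is linearized with an error; the quadratic regularizer is expanded exactly. Its strong
    convexity is why the right-hand side carries [Lh] and the left-hand side [Lh + eta]. *)
Lemma prox_grad_ineq y p u : prox_grad y p -> D u ->
  Phi p + (Lh + eta) / 2 * enorm (u - p) ^+ 2
    <= Phi u + Lh / 2 * enorm (u - y) ^+ 2.
Proof.
move=> yp Du.
have L0 : 0 < Lh + eta by rewrite addr_gt0.
have ga0 : 0 <= ga by rewrite invr_ge0 ltW.
have := prox_three_point ga0 yp Du.
have := convex_lower hL hc y u.
have := smooth_upper hL y p.
rewrite /Phi.
set G := grad h y + eta *: (y - z).
have -> : p - (y - ga *: G) = (p - y) + ga *: G by rewrite opprB addrA addrAC.
have -> : u - (y - ga *: G) = (u - y) + ga *: G by rewrite opprB addrA addrAC.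
have -> : u - p = (u - y) - (p - y) by rewrite opprB subrKA.
have -> : p - z = (p - y) + (y - z) by rewrite subrKA.
have -> : u - z = (u - y) + (y - z) by rewrite subrKA.
move=> H1 H2 H3.
have {}H3 : r p - r u + dotv (p - y) G - dotv (u - y) G <= (Lh + eta) *
    (2^-1 * (enorm (u - y) ^+ 2 - enorm (p - y) ^+ 2
     - enorm ((u - y) - (p - y)) ^+ 2)).
  rewrite -ler_pdivrMl//; move: H3; rewrite -/ga.
  move: (p - y) (u - y) G => a b G.
  rewrite !enorm2 !dotvE (dotvC G a) (dotvC G b) (dotvC b a).
  lra.
move: H1 H2 H3; rewrite /G; move: (p - y) (u - y) (y - z) => a b c.
rewrite !enorm2 !dotvE (dotvC b a) (dotvC c a) (dotvC c b).
by rewrite (dotvC _ a) (dotvC _ b); lra.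
Qed.

Variable th : R.
Hypotheses (th0 : 0 < th) (th1 : th < 1) (thE : eta = th ^+ 2 * (Lh + eta)).

(* [v] is the auxiliary point of the estimate sequence; the extrapolation
   coefficient places [y] on the segment from [x] to [v]. *)
Lemma lyapunov_step x y v p u : D x -> D u -> prox_grad y p ->
  y - x = (th / (1 + th)) *: (v - x) ->
  Phi p - Phi u + eta / 2 * enorm (x + th^-1 *: (p - x) - u) ^+ 2
    <= (1 - th) * (Phi x - Phi u + eta / 2 * enorm (v - u) ^+ 2).
Proof.
move=> Dx Du yp yx.
have t01 : 0 <= th <= 1 by rewrite !ltW.
have [Dt rt] := rc Du Dx t01.
have ht := convex_functionT hc u x t01.
have := prox_grad_ineq yp Dt; rewrite /Phi.
(* Testing the prox inequality at this convex combination makes [U - p] equal to [- th] times [w],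
   the new auxiliary point minus [u]. *)
set U := th *: u + (1 - th) *: x in Dt rt ht *.
set w := x + th^-1 *: (p - x) - u.
have s1 : 0 < 1 + th by rewrite addr_gt0.
have Up : enorm (U - p) ^+ 2 = th ^+ 2 * enorm w ^+ 2.
  have -> : U - p = (- th) *: w.
    by apply/rowP => i; rewrite !mxE; field; rewrite gt_eqF.
  by rewrite enormZ exprMn normrN real_normK// num_real.
(* Uses the position of [y] between [x] and [v], and [Lh * th ^+ 2 = eta * (1 - th) * (1 + th)]; the
   only loss is bounding [(1 + th)^-1] by 1. *)
have Uy : Lh * enorm (U - y) ^+ 2 <= eta * (1 - th) *
    ((1 + th) * enorm (u - x) ^+ 2 - 2 * dotv (u - x) (v - x)
     + enorm (v - x) ^+ 2).
  have -> : U - y = th *: ((u - x) - (1 + th)^-1 *: (v - x)).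
    have -> : U - y = th *: (u - x) - (y - x).
      by apply/rowP => i; rewrite !mxE; ring.
    by rewrite yx [in RHS]scalerBr scalerA.
  rewrite enormZ exprMn real_normK ?num_real// mulrA.
  have -> : Lh * th ^+ 2 = eta * (1 - th) * (1 + th) by move: thE; lra.
  have e0 : 0 <= eta * (1 - th) by apply: mulr_ge0; rewrite ?subr_ge0 ltW.
  rewrite -[leLHS]mulrA ler_wpM2l//.
  move: (u - x) (v - x) => a b; rewrite !enorm2 !dotvE (dotvC b a).
  rewrite [leLHS](_ : _ = (1 + th) * dotv a a - 2 * dotv a b
    + (1 + th)^-1 * dotv b b); last by field; rewrite gt_eqF.
  by rewrite lerD2l ler_piMl ?dotv_ge0// invf_le1// lerDl ltW.
move: Uy; rewrite Up.
have -> : U - z = th *: (u - x) + (x - z).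
  by apply/rowP => i; rewrite !mxE; ring.
have -> : u - z = (u - x) + (x - z) by rewrite subrKA.
have -> : v - u = (v - x) - (u - x) by rewrite opprB subrKA.
move: (u - x) (v - x) (x - z) => a b c.
rewrite (mulrA _ (th ^+ 2)) [X in X * enorm w ^+ 2](_ : _ = eta / 2);
  last first.
  by move: thE; lra.
rewrite !enorm2 !dotvE (dotvC b a) (dotvC c a); lra.
Qed.

(** Iterates [lyapunov_step] from [v = xs 0]. The recurrence is insensitive to the sign of
    [Phi x - Phi u], so [u] can be any point of [D]. *)
Lemma accelerated_decay (xs ys : nat -> V) J u : D u -> D (xs 0%N) ->
  ys 0%N = xs 0%N ->
  (forall j, (j < J)%N -> prox_grad (ys j) (xs j.+1)) ->
  (forall j, (j < J)%N ->
    ys j.+1 = xs j.+1 + ((1 - th) / (1 + th)) *: (xs j.+1 - xs j)) ->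
  Phi (xs J) - Phi u <=
    (1 - th) ^+ J * (Phi (xs 0%N) - Phi u + eta / 2 * enorm (xs 0%N - u) ^+ 2).
Proof.
move=> Du D0 y0 hp he.
set E0 := Phi _ - _ + _.
suff H j : (j <= J)%N -> D (xs j) /\ exists2 v,
    ys j - xs j = (th / (1 + th)) *: (v - xs j) &
    Phi (xs j) - Phi u + eta / 2 * enorm (v - u) ^+ 2 <= (1 - th) ^+ j * E0.
  have [_ [v _]] := H J (leqnn _); apply: le_trans.
  by rewrite lerDl mulr_ge0 ?sqr_ge0// divr_ge0// ltW.
elim: j => [_|j IH jJ].
  by split=> //; exists (xs 0%N); rewrite ?y0 ?subrr ?scaler0 ?expr0 ?mul1r.
have [Dj [v yv Ev]] := IH (ltnW jJ).
have pj := hp j jJ; split; first exact: pj.1.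
have s1 : 0 < 1 + th by rewrite addr_gt0.
(* With this next auxiliary point, the extrapolation rule is exactly the position of [ys j.+1]
   demanded by the invariant. *)
exists (xs j + th^-1 *: (xs j.+1 - xs j)).
  rewrite (he j jJ); apply/rowP => i; rewrite !mxE.
  by field; rewrite !gt_eqF.
apply: le_trans (lyapunov_step Dj Du pj yv) _.
by rewrite [in leRHS]exprS -[leRHS]mulrA ler_wpM2l// subr_ge0 ltW.
Qed.

End AcceleratedProximalGradient.

(** * Projections on closed convex sets and stability of nearest points *)

Section Projection.
Context {R : realType} {n : nat}.
Local Notation V := 'rV[R]_n.
Implicit Types (A : set V).

Lemma enormB_continuous (s : V) : continuous (fun u : V => enorm (s - u)).
Proof.
move=> u.
have H : {for u, continuous (fun u : V => s - u)}.
  by apply: continuousB => //; exact: cst_continuous.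
have H2 : {for (s - u), continuous (enorm : V -> R)} by exact: enorm_continuous.
exact: (continuous_comp H H2).
Qed.

Lemma closed_enorm_le (s : V) M : closed [set u | enorm (u - s) <= M].
Proof.
rewrite (_ : mkset _ = (fun u => enorm (s - u)) @^-1` [set t | t <= M]).
  apply: preimage_closed; first by move=> u _; exact: enormB_continuous.
  exact: closed_le.
by apply/seteqP; split=> u /=; rewrite enormB.
Qed.

Lemma closed_enorm_ge (s : V) M : closed [set u | M <= enorm (u - s)].
Proof.
rewrite (_ : mkset _ = (fun u => enorm (s - u)) @^-1` [set t | M <= t]).
  apply: preimage_closed; first by move=> u _; exact: enormB_continuous.
  exact: closed_ge.
by apply/seteqP; split=> u /=; rewrite enormB.
Qed.

Lemma enorm_compact A s M : closed A ->
  (forall u, A u -> enorm (u - s) <= M) -> compact A.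
Proof.
by move=> Ac AM; apply: bounded_closed_compact Ac; exact: enorm_bounded AM.
Qed.

Lemma nearest_nonempty A x : closed A -> A !=set0 -> nearest A x !=set0.
Proof.
move=> Ac [a Aa].
(* Cutting [A] by the ball through [a] gives a compact set on which the distance attains its
   minimum; points outside the ball are farther than [a]. *)
pose K := A `&` [set u | enorm (u - x) <= enorm (a - x)].
have Kc : compact K.
  apply: (@enorm_compact _ x (enorm (a - x))); last by move=> u [].
  by apply: closedI => //; exact: closed_enorm_le.
have [||p] := @EVT_min_rV R n (fun u => enorm (x - u)) K _ Kc.
- by exists a; split=> //=.
- by apply: continuous_subspaceT; exact: enormB_continuous.
rewrite inE => -[Ap _] pmin; exists p; split=> // u Au.
have [ux|/ltW xu] := leP (enorm (u - x)) (enorm (a - x)).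
  by apply: pmin; rewrite inE.
have : enorm (x - p) <= enorm (x - a) by apply: pmin; rewrite inE; split=> /=.
by move/le_trans; apply; rewrite !(enormB x).
Qed.

Lemma proj_nearest A x : closed A -> A !=set0 -> nearest A x (Defs.proj A x).
Proof.
by move=> Ac A0; have [p px] := nearest_nonempty x Ac A0; exact: xgetI px.
Qed.

Lemma nearest_obtuse A x p u :
  (forall v w t, A v -> A w -> 0 <= t <= 1 -> A (t *: v + (1 - t) *: w)) ->
  nearest A x p -> A u -> dotv (x - p) (u - p) <= 0.
Proof.
move=> Acvx [Ap pmin] Au.
apply: (@le_of_small _ _ _ (2^-1 * enorm (u - p) ^+ 2)) => t /andP[t0 t1].
have := pmin _ (Acvx u p t Au Ap _); rewrite ltW// t1 => /(_ isT).
have -> : x - (t *: u + (1 - t) *: p) = (x - p) - t *: (u - p).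
  by apply/rowP => i; rewrite !mxE; ring.
rewrite -(@ler_pXn2r _ 2) ?nnegrE ?enorm_ge0//.
move: (x - p) (u - p) => a b; rewrite !enorm2 !dotvE (dotvC b a) => H.
rewrite -(ler_pM2l t0); lra.
Qed.

Lemma nearest_dist A x p : nearest A x p -> dist x A = enorm (x - p).
Proof.
move=> [Ap pmin]; apply/eqP; rewrite eq_le; apply/andP; split.
  apply: ge_inf; last by exists p.
  by exists 0 => _ [u _ <-]; exact: enorm_ge0.
apply: lb_le_inf; first by exists (enorm (x - p)), p.
by move=> _ [u Au <-]; exact: pmin.
Qed.

(** Compactness: otherwise there are bounded points of [C k.+1%:R^-1] at distance at least [e] from
    [A]; a cluster point lies in every [C d], hence in [A], yet at distance at least [e] from
    itself. *)
Lemma sublevel_near (C : R -> set V) A s M e :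
  (forall d, 0 < d -> closed (C d)) ->
  (forall d d', d <= d' -> C d `<=` C d') ->
  (forall p, (forall d, 0 < d -> C d p) -> A p) -> 0 < e ->
  exists2 d, 0 < d & forall w, C d w -> enorm (w - s) <= M ->
    exists2 q, A q & enorm (w - q) < e.
Proof.
move=> Ccl Cmono CA e0; apply: contrapT => H.
have {}H k : exists w, [/\ C k.+1%:R^-1 w, enorm (w - s) <= M &
    forall q, A q -> e <= enorm (w - q)].
  apply: contrapT => H1; apply: H; exists k.+1%:R^-1; first by rewrite invr_gt0.
  move=> w Cw wM; apply: contrapT => H2; apply: H1; exists w; split=> // q Aq.
  by rewrite leNgt; apply/negP => wq; apply: H2; exists q.
have [w wP] := choice H.
have Kc : compact [set u : V | enorm (u - s) <= M].
  by apply: (@enorm_compact _ s M) => //; exact: closed_enorm_le.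
have [|p [_ pcl]] := Kc (w @ \oo) _.
  by exists 0%N => // k _ /=; have [] := wP k.
have incl (F : set V) : closed F -> (\forall k \near \oo, F (w k)) -> F p.
  move=> Fcl wF; apply: Fcl; move: pcl; rewrite clusterE; exact.
have Ap : A p.
  apply: CA => d d0; apply: incl; first exact: Ccl.
  near=> k; have [+ _ _] := wP k; apply: Cmono.
  apply: ltW; near: k; exact: (near_infty_natSinv_lt (PosNum d0)).
have : e <= enorm (p - p).
  apply: (incl [set u | e <= enorm (u - p)]); first exact: closed_enorm_ge.
  by near=> k; have [_ _] := wP k; exact.
rewrite subrr leNgt => /negP; apply.
by rewrite -(scale0r 0) enormZ normr0 mul0r.
Unshelve. all: by end_near. Qed.

(** Take [q] in [A] close to [w]. The obtuse angle at [p] gives |q - p|^2 <= |q - z|^2 - |p - z|^2,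
    which is small since [w] is almost as close to [z] as [p] is. The tolerance [d] is uniform in
    [w], [z] and [p]. *)
Lemma tikhonov_near (C : R -> set V) A s M Q e :
  (forall d, 0 < d -> closed (C d)) ->
  (forall d d', d <= d' -> C d `<=` C d') ->
  (forall p, (forall d, 0 < d -> C d p) -> A p) ->
  (forall v w t, A v -> A w -> 0 <= t <= 1 -> A (t *: v + (1 - t) *: w)) ->
  0 < e ->
  exists2 d, 0 < d & forall w z p, C d w -> enorm (w - s) <= M ->
    nearest A z p -> enorm (z - p) <= Q ->
    enorm (w - z) ^+ 2 <= enorm (p - z) ^+ 2 + d -> enorm (w - p) <= e.
Proof.
move=> Ccl Cmono CA Acvx e0.
pose Q1 := `|Q| + 1.
have Q10 : 1 <= Q1 by rewrite lerDr.
(* Since |q - z| <= |w - z| + tau and |w - z| <= Q1, |q - p|^2 is at most d + 2 tau Q1 + tau^2, that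
   is at most four times e^2 / 16. *)
pose tau := Num.min (Num.min 1 (e / 2)) (e ^+ 2 / 16 / Q1).
have tau0 : 0 < tau by rewrite !lt_min ltr01 !divr_gt0// ?exprn_gt0//; lra.
have [d0 d00 Hd0] := sublevel_near s M Ccl Cmono CA tau0.
exists (Num.min (Num.min 1 d0) (e ^+ 2 / 16)).
  by rewrite !lt_min ltr01 d00 divr_gt0// exprn_gt0.
move=> w z p Cw wM zp zpQ.
set d := Num.min _ _ in Cw * => wz.
have d1 : d <= 1 by rewrite /d !ge_min lexx.
have dd0 : d <= d0 by rewrite /d !ge_min lexx orbT.
have de : d <= e ^+ 2 / 16 by rewrite /d ge_min lexx orbT.
have [q Aq wq] := Hd0 w (Cmono _ _ dd0 _ Cw) wM.
have t1 : tau <= 1 by rewrite /tau !ge_min lexx.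
have te : tau <= e / 2 by rewrite /tau !ge_min lexx orbT.
have tq : tau * Q1 <= e ^+ 2 / 16.
  by rewrite -ler_pdivlMr ?/tau ?ge_min ?lexx ?orbT//; lra.
have vi := nearest_obtuse Acvx zp Aq.
have qp : enorm (q - p) ^+ 2 <= enorm (q - z) ^+ 2 - enorm (p - z) ^+ 2.
  have -> : q - z = (q - p) - (z - p) by rewrite opprB subrKA.
  rewrite (enormB p z); move: vi; move: (z - p) (q - p) => a b.
  by rewrite !enorm2 !dotvE (dotvC b a); lra.
have zpQ1 : enorm (p - z) + 1 <= Q1.
  by rewrite enormB lerD2r; apply: le_trans zpQ (ler_norm _).
have W0 := enorm_ge0 (w - z).
have P0 := enorm_ge0 (p - z).
have WQ : enorm (w - z) <= Q1.
  rewrite -(@ler_pXn2r _ 2) ?nnegrE//; last by lra.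
  by apply: le_trans wz _; nra.
have qz : enorm (q - z) <= enorm (w - z) + tau.
  by have := ler_enorm_dist w q z; rewrite (enormB q w); lra.
have qpe : enorm (q - p) <= e / 2.
  have := enorm_ge0 (q - z); move: (enorm (q - z)) qz qp => B qz qp B0.
  rewrite -(@ler_pXn2r _ 2) ?nnegrE ?enorm_ge0//; last by lra.
  nra.
have := ler_enorm_dist q w p; lra.
Qed.

End Projection.

(** * Asymptotics of the regularization weight and of the contraction factor *)

Section StepsizeSchedule.
Context {R : realType}.
Variables (Lh etab : R).
Hypotheses (Lh0 : 0 < Lh) (etab0 : 0 < etab).
Local Notation eta := (eta Lh etab).

Lemma eta_gt0 J : (1 < J)%N -> 0 < eta J.
Proof.
move=> J1; have J0 : 0 < J%:R :> R by rewrite ltr0n (ltn_trans _ J1).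
rewrite /Defs.eta mulr_gt0 ?exprn_gt0 ?divr_gt0 ?ln_gt0 ?ltr1n//.
by rewrite mulr_gt0 ?addr_gt0.
Qed.

(** Sublinearity of the logarithm at the square root of J gives (ln J / J)^2 <= 4 / J, whence 64 =
    16 * 4. *)
Lemma eta_le J : (0 < J)%N -> eta J <= 64 * (Lh + etab) / J%:R.
Proof.
move=> J0; have r0 : 0 < J%:R :> R by rewrite ltr0n.
have [s s0 sE] : exists2 s : R, 0 < s & J%:R = s ^+ 2.
  by exists (Num.sqrt J%:R); rewrite ?sqrtr_gt0// sqr_sqrtr// ltW.
have lnJ : ln J%:R <= 2 * s.
  rewrite sE lnXn// mulr2n; have := ltW (ln_sublinear s0); lra.
have lnJ0 : 0 <= ln (J%:R : R) by rewrite ln_ge0// ler1n.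
have c0 : 0 < Lh + etab by rewrite addr_gt0.
rewrite /Defs.eta ler_pdivlMr//; move: (ln _) lnJ lnJ0 => l ls l0.
rewrite sE [leLHS](_ : _ = (Lh + etab) * (16 * (l / s) ^+ 2)); last first.
  by field; rewrite gt_eqF.
have ls2 : l / s <= 2 by rewrite ler_pdivrMr.
have ls0 : 0 <= l / s by rewrite divr_ge0// ltW.
by rewrite [leRHS]mulrC ler_pM2l//; nra.
Qed.

Lemma eta_cvg0 e : 0 < e -> \forall J \near \oo, eta J <= e.
Proof.
move=> e0; have c0 : 0 < 64 * (Lh + etab) by rewrite mulr_gt0// addr_gt0.
near=> J.
have J0 : (0 < J)%N by near: J; exists 1%N.
have r0 : 0 < J%:R :> R by rewrite ltr0n.
apply: le_trans (eta_le J0) _; rewrite ler_pdivrMr// -ler_pdivrMl//.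
near: J; exact: nbhs_infty_ger.
Unshelve. all: by end_near. Qed.

Lemma inv4_div_eta_cvg0 e : 0 < e ->
  \forall J \near \oo, (J%:R ^+ 4)^-1 <= e * eta J.
Proof.
move=> e0; have c0 : 0 < 16 * (Lh + etab) by rewrite mulr_gt0// addr_gt0.
have l2 : 0 < ln (2 : R) by rewrite ln_gt0// ltr1n.
near=> J.
have J1 : (1 < J)%N by near: J; exists 2%N.
have r0 : 0 < J%:R :> R by rewrite ltr0n (ltn_trans _ J1).
have r1 : 1 <= J%:R :> R by rewrite ler1n (ltn_trans _ J1).
have lJ : ln 2 <= ln J%:R :> R by rewrite ler_ln ?posrE// ler_nat.
have JN : (e * (16 * (Lh + etab)) * ln 2 ^+ 2)^-1 <= J%:R.
  near: J; exact: nbhs_infty_ger.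
have d0 : 0 < e * (16 * (Lh + etab)) * ln 2 ^+ 2.
  by apply: mulr_gt0; [exact: mulr_gt0|exact: exprn_gt0].
rewrite /Defs.eta expr_div_n.
rewrite -(ler_pM2r (_ : 0 < J%:R ^+ 4)) ?exprn_gt0// mulVf ?gt_eqF ?exprn_gt0//.
rewrite [leRHS](_ : _ = e * (16 * (Lh + etab)) * ln J%:R ^+ 2 * J%:R ^+ 2);
  last by field; rewrite gt_eqF.
rewrite invf_ple ?posrE// in JN.
have H1 : e * (16 * (Lh + etab)) * ln 2 ^+ 2 <=
    e * (16 * (Lh + etab)) * ln J%:R ^+ 2.
  have lJ0 := lt_le_trans l2 lJ.
  have d1 : 0 < e * (16 * (Lh + etab)) by exact: mulr_gt0.
  by rewrite ler_pM2l// ler_pXn2r// nnegrE ltW.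
apply: le_trans (_ : J%:R^-1 * J%:R ^+ 2 <= _).
  by rewrite expr2 mulrA mulVf ?mul1r// gt_eqF.
by rewrite ler_wpM2r ?sqr_ge0//; exact: le_trans H1.
Unshelve. all: by end_near. Qed.

(** Here [th] is the inverse square root of [kappa]. The decay combines [1 - th <= expR (- th)] with
    [th >= 4 * ln J / J]. *)
Lemma theta_props J (th := Num.sqrt (eta J / (Lh + eta J))) : (1 < J)%N ->
  eta J <= etab ->
  [/\ 0 < th < 1, eta J = th ^+ 2 * (Lh + eta J),
      momentum Lh etab J = (1 - th) / (1 + th) &
      (1 - th) ^+ J <= (J%:R ^+ 4)^-1].
Proof.
move=> J1 eb; have e0 := eta_gt0 J1.
have L0 : 0 < Lh + eta J by rewrite addr_gt0.
have q0 : 0 < eta J / (Lh + eta J) by rewrite divr_gt0.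
have th0 : 0 < th by rewrite sqrtr_gt0.
have th1 : th < 1.
  by rewrite -sqrtr1 ltr_sqrt// ltr_pdivrMr// mul1r ltrDr.
have r0 : 0 < J%:R :> R by rewrite ltr0n (ltn_trans _ J1).
split.
- by rewrite th0.
- by rewrite sqr_sqrtr ?ltW// divfK// gt_eqF.
- rewrite /momentum /kappa -[X in Num.sqrt X]invf_div sqrtrV ?ltW// -/th.
  have := th0 => th0'; field; apply/andP; split; rewrite gt_eqF//.
  by rewrite addr_gt0.
(* This is where [eta J <= etab] enters: [Lh + eta J] is at most [Lh + etab], so the ratio under the
   root is at least 16 (ln J / J)^2. *)
have th4 : 4 * ln J%:R / J%:R <= th.
  have l0 : 0 < 4 * ln J%:R / J%:R :> R.
    by rewrite divr_gt0// mulr_gt0// ln_gt0// ltr1n.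
  rewrite -(ger0_norm (ltW l0)) -sqrtr_sqr ler_wsqrtr//.
  rewrite ler_pdivlMr// [leRHS]/Defs.eta.
  rewrite [leLHS](_ : _ = 16 * ((Lh + eta J) * (ln J%:R / J%:R) ^+ 2));
    last by field; rewrite gt_eqF.
  by rewrite -[leRHS]mulrA ler_pM2l// ler_wpM2r ?sqr_ge0// lerD2l.
apply: le_trans (_ : expR (- th) ^+ J <= _).
  have a0 : 0 <= 1 - th by rewrite subr_ge0 ltW.
  by rewrite lerXn2r ?nnegrE ?expR_ge0// expR_ge1Dx.
rewrite -expRM_natr -[X in X^-1]lnK ?posrE ?exprn_gt0// -expRN ler_expR.
rewrite lnXn// mulNr lerN2 -(mulr_natl _ 4).
by move: th4; rewrite ler_pdivrMr.
Qed.

End StepsizeSchedule.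

(** * The composite lower-level objective and its solution set *)

Section CompositeObjective.
Context {R : realType} {n : nat}.
Local Notation V := 'rV[R]_n.
Variables (f h : V -> R) (omega : V -> \bar R) (Lf Lh : R).
Hypothesis hB : assumptionB f Lf h Lh omega.

Definition fin_part (u : V) : R := fine (omega u).
Definition hval (u : V) : R := h u + fin_part u.

Let D := edom omega.
Let r := fin_part.
Let H := hval.
Let S := argmin (hbar h omega).

Lemma omega_edom u : D u -> omega u = (r u)%:E.
Proof.
move=> Du; rewrite /r /fin_part fineK// fin_numElt.
by rewrite (aB_omega_proper hB).1; exact: Du.
Qed.

Lemma omega_notin u : ~ D u -> omega u = +oo%E.
Proof. by move=> nDu; apply/eqP; rewrite -leye_eq leNgt; apply/negP. Qed.

Lemma hbar_edom u : D u -> hbar h omega u = (H u)%:E.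
Proof. by move=> Du; rewrite /hbar omega_edom. Qed.

Lemma hbar_le_edom u c : (hbar h omega u <= c%:E)%E <-> D u /\ H u <= c.
Proof.
split=> [|[Du Hu]]; last by rewrite hbar_edom// lee_fin.
have [Du|nDu] := pselect (D u); first by rewrite hbar_edom// lee_fin.
by rewrite /hbar omega_notin.
Qed.

Lemma convex_on_fin_part : convex_on D r.
Proof.
move=> u v t Du Dv t01; have := aB_omega_convex hB u v t01.
rewrite (omega_edom Du) (omega_edom Dv) -!EFinM -EFinD => le.
have Dt : D (t *: u + (1 - t) *: v) by exact: le_lt_trans le (ltry _).
by split=> //; rewrite -lee_fin -(omega_edom Dt).
Qed.

Lemma prox_is_prox ga w p : 0 < ga ->
  prox (fun u => ga%:E * omega u)%E w p -> is_prox D r ga w p.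
Proof.
move=> ga0 pp; have Dp : D p.
  have [_ [u Du]] := aB_omega_proper hB.
  apply: contrapT => nDp; have := pp u.
  by rewrite /= (omega_notin nDp) (omega_edom Du) gt0_muley ?lte_fin.
split=> // u Du; have := pp u.
by rewrite /= (omega_edom Dp) (omega_edom Du) -!EFinM -!EFinD lee_fin.
Qed.

(** The sublevel set is the preimage of the epigraph of [omega] under the continuous map sending [u]
    to [(u, c - h u)]. *)
Lemma hbar_sublevel_closed c : closed [set u | (hbar h omega u <= c%:E)%E].
Proof.
have hcont : continuous h.
  by move=> u; apply: differentiable_continuous; exact: (aB_h_smooth hB).1.
rewrite (_ : mkset _ =
  (fun u => (u, c - h u)) @^-1` [set p : V * R | (omega p.1 <= p.2%:E)%E]).
  apply: preimage_closed; last exact: (aB_omega_closed hB).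
  move=> u _.
  have hu : {for u, continuous (fun v => c - h v)}.
    by apply: continuousB; [exact: cst_continuous|exact: hcont].
  have iu : {for u, continuous (@id V)} by [].
  exact: (@cvg_pair V V R (nbhs u) (nbhs u) (nbhs (c - h u)) _ _ _ id
    (fun v => c - h v) iu hu).
apply/seteqP; split=> u /=; rewrite EFinB leeBrDl// ?fin_numE//.
Qed.

Lemma argmin_le s u : S s -> S u <-> (hbar h omega u <= (H s)%:E)%E.
Proof.
move=> Ss; have Ds : D s.
  have [_ [v Dv]] := aB_omega_proper hB.
  by have := Ss v; rewrite (hbar_edom Dv) => /hbar_le_edom[].
rewrite -hbar_edom//; split=> [Su|su v]; first exact: Su.
exact: le_trans su (Ss v).
Qed.

Lemma argmin_edom u : S u -> D u.
Proof. by move=> Su; have /hbar_le_edom[] := (argmin_le u Su).1 Su. Qed.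

Lemma hval_argmin s u : S s -> D u -> H s <= H u.
Proof.
move=> Ss Du; have := Ss u.
by rewrite (hbar_edom Du) (hbar_edom (argmin_edom Ss)) lee_fin.
Qed.

Lemma argmin_closed : closed S.
Proof.
have [s Ss] := aB_argmin_nonempty hB.
rewrite (_ : S = [set u | (hbar h omega u <= (H s)%:E)%E]).
  exact: hbar_sublevel_closed.
by apply/seteqP; split=> u /(argmin_le u Ss).
Qed.

Lemma argmin_convex u v t : S u -> S v -> 0 <= t <= 1 ->
  S (t *: u + (1 - t) *: v).
Proof.
move=> Su Sv t01; apply/(argmin_le _ Su)/hbar_le_edom.
have Du := argmin_edom Su; have Dv := argmin_edom Sv.
have [Dt rt] := convex_on_fin_part Du Dv t01; split=> //.
have ht := convex_functionT (aB_h_convex hB) u v t01.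
have E : H v = H u by apply/le_anti; rewrite !hval_argmin.
rewrite {1}/H /hval; apply: le_trans (lerD ht rt) _.
suff -> : H u = t * H u + (1 - t) * H v by rewrite /H /hval -/r; lra.
by rewrite E; ring.
Qed.

End CompositeObjective.

(** * Estimates for one outer iteration *)

Section OuterLoop.
Context {R : realType} {n : nat}.
Local Notation V := 'rV[R]_n.
Variables (f h : V -> R) (omega : V -> \bar R) (Lf Lh gammah etab : R).
Variables (J : nat -> nat) (B : set V) (xh : nat -> V) (x y : nat -> nat -> V).
Hypotheses (hB : assumptionB f Lf h Lh omega).
Hypotheses (hin : ipr_vfista_input Lf gammah J etab h omega B).
Hypotheses (hrun : ipr_vfista f h omega Lh gammah etab J B xh x y).

Let D := edom omega.
Let H := hval h omega.
Let S := argmin (hbar h omega).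
Let z k := xh k - gammah *: grad f (xh k).
Let p k := Defs.proj S (z k).
Let eta k := Defs.eta Lh etab (J k).

Lemma gammah_Lf_le : gammah * Lf <= 2^-1.
Proof.
have [_ +] := andP (in_gammah hin).
by rewrite invfM -ler_pdivlMr ?(aB_Lf_gt0 hB)// mulrC.
Qed.

Lemma nearest_target k : nearest S (z k) (p k).
Proof.
by apply: proj_nearest; [exact: argmin_closed hB|exact: aB_argmin_nonempty hB].
Qed.

(** As [J k] is positive, the last inner iterate comes from a prox step. Its stepsize is positive
    even for [J k = 1], where the regularization weight is 0. *)
Lemma run_edom k : D (xh k.+1).
Proof.
rewrite (run_outer hrun); have := in_J_gt0 hin k.
case E : (J k) => [//|j] _.
have jJ : (j < J k)%N by rewrite E.
have := run_prox hrun jJ => /= /(prox_is_prox hB)[]//.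
rewrite invr_gt0 ltr_wpDr ?(aB_Lh_gt0 hB)// mulr_ge0 ?sqr_ge0//.
by rewrite mulr_ge0// addr_ge0 ?ltW ?(aB_Lh_gt0 hB) ?(in_etab hin).
Qed.

Lemma inner_loop_bound k u : D u -> D (x k 0%N) -> y k 0%N = x k 0%N ->
  (1 < J k)%N -> eta k <= etab -> H u <= H (x k 0%N) ->
  H (xh k.+1) + eta k / 2 * enorm (xh k.+1 - z k) ^+ 2 <=
  H u + eta k / 2 * enorm (u - z k) ^+ 2 + ((J k)%:R ^+ 4)^-1 *
    (H (x k 0%N) - H u + eta k / 2 *
      (enorm (x k 0%N - z k) ^+ 2 + enorm (x k 0%N - u) ^+ 2)).
Proof.
move=> Du D0 y0 J1 eb Hu.
have Lh0 := aB_Lh_gt0 hB.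
have e0 : 0 < eta k := eta_gt0 Lh0 (in_etab hin) J1.
have [/andP[th0 th1] thE mom decay] := theta_props Lh0 (in_etab hin) J1 eb.
move: (Num.sqrt _) th0 th1 thE mom decay => th th0 th1 thE mom decay.
have ga0 : 0 < (Lh + eta k)^-1 by rewrite invr_gt0 addr_gt0.
have pg j : (j < J k)%N ->
    prox_grad D (fin_part omega) h Lh (eta k) (z k) (y k j) (x k j.+1).
  by move=> jJ; exact: (prox_is_prox hB ga0 (run_prox hrun jJ)).
have ex j : (j < J k)%N ->
    y k j.+1 = x k j.+1 + ((1 - th) / (1 + th)) *: (x k j.+1 - x k j).
  by move=> jJ; rewrite -mom; exact: (run_extrapolate hrun jJ).
have := accelerated_decay (convex_on_fin_part hB) Lh0 e0 (aB_h_smooth hB)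
  (aB_h_convex hB) th0 th1 thE Du D0 y0 pg ex.
rewrite -(run_outer hrun).
set E0 := (X in _ <= _ * X -> _); set E1 := (X in _ -> _ <= _ + _ * X) => E.
(* [E0] may be negative, so it is first enlarged to the nonnegative [E1]; only then can its factor
   be replaced by the larger J^-4. *)
have E01 : E0 <= E1.
  rewrite /E0 /E1 /H /hval.
  have : 0 <= eta k / 2 * enorm (u - z k) ^+ 2.
    by rewrite mulr_ge0 ?sqr_ge0// divr_ge0// ltW.
  lra.
have E10 : 0 <= E1.
  by rewrite addr_ge0 ?subr_ge0// mulr_ge0 ?addr_ge0 ?sqr_ge0// divr_ge0 ?ltW.
have c0 : 0 <= (1 - th) ^+ J k by rewrite exprn_ge0// subr_ge0 ltW.
have : (1 - th) ^+ J k * E0 <= ((J k)%:R ^+ 4)^-1 * E1.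
  by apply: le_trans (ler_wpM2l c0 E01) _; exact: ler_wpM2r.
move: E; rewrite /H /hval; lra.
Qed.

Variable s : V.
Hypothesis Ss : S s.
Let Z M := 3 / 2 * M + gammah * enorm (grad f s).

(** The 3/2 in [Z] is 1 plus the bound 1/2 on [gammah * Lf]: the gradient at [xh k] is compared with
    the gradient at [s]. *)
Lemma grad_step_bound k M : enorm (xh k - s) <= M -> enorm (z k - s) <= Z M.
Proof.
move=> dM.
have [g0 _] := andP (in_gammah hin).
have gL := gammah_Lf_le.
have -> : z k - s = (xh k - s) + (- gammah) *: grad f (xh k).
  by apply/rowP => i; rewrite !mxE; ring.
apply: le_trans (ler_enormD _ _) _.
rewrite enormZ normrN gtr0_norm//.
have := (aB_f_smooth hB).2 (xh k) s.
have := ler_enormD (grad f (xh k) - grad f s) (grad f s); rewrite subrK.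
have := enorm_ge0 (xh k - s); rewrite /Z; nra.
Qed.

Lemma grad_step_proj_bound k M : enorm (xh k - s) <= M ->
  enorm (z k - p k) <= Z M /\ enorm (p k - s) <= 2 * Z M.
Proof.
move=> /grad_step_bound zs; have [_ /(_ s Ss) zp] := nearest_target k.
split; first exact: le_trans zs.
by have := ler_enorm_dist (z k) (p k) s; rewrite (enormB (p k) (z k)); lra.
Qed.

(** Restarting in [B] makes the bounds uniform in [k]. They start at index 1 because [x 0 0] is
    arbitrary, hence the shifted indices in what follows. *)
Lemma restart_bounds : exists Mb Cb, [/\ 0 <= Mb, 0 <= Cb & forall k,
  [/\ D (x k.+1 0%N), enorm (x k.+1 0%N - s) <= Mb &
      H (x k.+1 0%N) - H s <= Cb]].
Proof.
have [Mb Mb0 BM] := bounded_enorm s (compact_bounded (in_B_compact hin)).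
have [C BC] : exists C, forall u, B u -> H u <= C.
  have [b0 Bb0] := in_B_nonempty hin.
  have := in_B_sup hin; case E : (ereal_sup _) => [C| |] // _.
    exists C => u Bu; rewrite -lee_fin -E -(hbar_edom hB);
      last exact: in_B_dom hin _ Bu.
    by apply: ereal_sup_ubound; exists u.
  have : (hbar h omega b0 <= ereal_sup (hbar h omega @` B))%E.
    by apply: ereal_sup_ubound; exists b0.
  by rewrite E (hbar_edom hB)//; exact: in_B_dom hin _ Bb0.
have x0B k : B (x k.+1 0%N) by have [] := run_restart hrun k.
exists Mb, (C - H s); split=> // [|k].
  have Bx := x0B 0%N; rewrite subr_ge0.
  apply: le_trans (BC _ Bx); apply: (hval_argmin hB Ss).
  exact: in_B_dom hin _ Bx.
split; [exact: in_B_dom hin _ (x0B k)|exact: BM|].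
by rewrite lerD2r; exact: BC.
Qed.

(** This is [inner_loop_bound] at the projection [p k.+1], where [H] is minimal; [Mb + 2 * Z M]
    bounds the distance of the restart point to both [z k.+1] and [p k.+1]. *)
Lemma outer_step_bound : exists Mb Cb, [/\ 0 <= Mb, 0 <= Cb &
  forall k M, enorm (xh k.+1 - s) <= M -> (1 < J k.+1)%N -> eta k.+1 <= etab ->
  H (xh k.+2) - H s + eta k.+1 / 2 * enorm (xh k.+2 - z k.+1) ^+ 2 <=
  eta k.+1 / 2 * enorm (p k.+1 - z k.+1) ^+ 2 + ((J k.+1)%:R ^+ 4)^-1 *
    (Cb + eta k.+1 * (Mb + 2 * Z M) ^+ 2)].
Proof.
have [Mb [Cb [Mb0 Cb0 HB]]] := restart_bounds.
exists Mb, Cb; split=> // k M dM J1 eb.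
have [Dx0 x0M x0C] := HB k.
have [zp ps] := grad_step_proj_bound dM.
have zs := grad_step_bound dM.
have Sp : S (p k.+1) by have [] := nearest_target k.+1.
have Dp := argmin_edom hB Sp.
have Hps : H (p k.+1) = H s.
  by apply/le_anti; rewrite !(hval_argmin hB)//; exact: argmin_edom hB _ Ss.
have Hpx : H (p k.+1) <= H (x k.+1 0%N) by exact: (hval_argmin hB).
have e0 : 0 < eta k.+1 := eta_gt0 (aB_Lh_gt0 hB) (in_etab hin) J1.
have := inner_loop_bound Dp Dx0 (run_restart_y hrun k) J1 eb Hpx.
rewrite Hps => E.
have Z0 : 0 <= Z M := le_trans (enorm_ge0 _) zs.
set W := Mb + 2 * Z M.
have xz : enorm (x k.+1 0%N - z k.+1) ^+ 2 <= W ^+ 2.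
  rewrite ler_pXn2r ?nnegrE ?enorm_ge0//; last by rewrite /W; lra.
  by have := ler_enorm_dist s (x k.+1 0%N) (z k.+1); rewrite (enormB s) /W; lra.
have xp : enorm (x k.+1 0%N - p k.+1) ^+ 2 <= W ^+ 2.
  rewrite ler_pXn2r ?nnegrE ?enorm_ge0//; last by rewrite /W; lra.
  by have := ler_enorm_dist s (x k.+1 0%N) (p k.+1); rewrite (enormB s) /W; lra.
have : ((J k.+1)%:R ^+ 4)^-1 * (H (x k.+1 0%N) - H s + eta k.+1 / 2 *
      (enorm (x k.+1 0%N - z k.+1) ^+ 2 + enorm (x k.+1 0%N - p k.+1) ^+ 2))
   <= ((J k.+1)%:R ^+ 4)^-1 * (Cb + eta k.+1 * W ^+ 2).
  rewrite ler_wpM2l ?invr_ge0 ?exprn_ge0//.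
  apply: lerD => //.
  rewrite -[leLHS]mulrA ler_wpM2l//; first exact: ltW.
  by lra.
lra.
Qed.

End OuterLoop.

(** * Scalar sequences and one inexact projected gradient step *)

Lemma contraction_bounded (R : realType) (d : nat -> R) c N :
  (forall k, (N <= k)%N -> d k.+1 <= d k / 2 + c) ->
  exists M, forall k, (N <= k)%N -> d k <= M.
Proof.
(* [2 * c] is the fixed point of t -> t / 2 + c, so any bound at least that large is preserved. *)
move=> dc; exists (Num.max (d N) (2 * c)) => k Nk.
rewrite -(subnK Nk); elim: (k - N)%N => [|m IH].
  by rewrite add0n le_max lexx.
apply: le_trans (dc _ (leq_addl _ _)) _.
have : 2 * c <= Num.max (d N) (2 * c) by rewrite le_max lexx orbT.
lra.
Qed.

Lemma no_uniform_descent (R : realType) (a : nat -> R) l c N : 0 < c ->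
  (forall k, l <= a k) -> ~ (forall k, (N <= k)%N -> a k.+1 <= a k - c).
Proof.
move=> c0 la ac.
have H m : a (m + N)%N <= a N - m%:R * c.
  elim: m => [|m IH]; first by rewrite add0n mul0r subr0.
  apply: le_trans (ac _ (leq_addl _ _)) _.
  by rewrite -addn1 natrD; lra.
have q0 : 0 <= (a N - l) / c.
  by apply: divr_ge0; [rewrite subr_ge0|exact: ltW].
have := archi_boundP q0; rewrite ltr_pdivrMr//.
move: (Num.Def.archi_bound _) => m.
by have := H m; have := la (m + N)%N; lra.
Qed.

Lemma limn_einf_eq0 (R : realType) (u : nat -> R) : (forall k, 0 <= u k) ->
  (forall N e, 0 < e -> exists2 k, (N <= k)%N & u k <= e) ->
  limn_einf (fun k => (u k)%:E) = 0%E.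
Proof.
move=> u0 ule.
have E N : einfs (fun k => (u k)%:E) N = 0%E.
  apply/le_anti/andP; split.
    apply/lee_addgt0Pr => e e0; rewrite add0e.
    have [k Nk uk] := ule N e e0.
    apply: (le_trans (_ : _ <= (u k)%:E)%E); last by rewrite lee_fin.
    by apply: ereal_inf_lbound; exists k.
  by apply: le_ereal_inf_tmp => _ [k _ <-]; rewrite lee_fin.
rewrite limn_einf_lim (_ : einfs _ = cst 0%E); first by rewrite lim_cst.
exact/funext.
Qed.

(* [w - r] is the projected gradient step from [w]; [a] and [a'] are the errors
   made in computing the previous and the current projected step. *)
Lemma inexact_projected_step (R : realType) n (f : 'rV[R]_n -> R)
    (Lf gammah Q G tau : R) (w r a a' : 'rV[R]_n) (g := grad f w) :
  smooth Lf f -> 0 < gammah -> gammah * Lf <= 2^-1 -> 0 < tau -> tau <= 1 ->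
  enorm g <= G -> enorm (r - gammah *: g) <= Q ->
  enorm a <= tau -> enorm a' <= tau -> dotv (r - gammah *: g) (r - a) <= 0 ->
  gammah * f (w + (a' - r)) <=
    gammah * f w - 2^-1 * enorm r ^+ 2 + tau * (gammah * G + Q + 1).
Proof.
move=> fL g0 gL tau0 tau1 gG rQ aE aE' vi.
have CS : dotv (r - gammah *: g) a <= Q * tau.
  by apply: le_trans (dotv_le_enorm _ _) _; apply: ler_pM; rewrite ?enorm_ge0.
have rg : dotv r r - gammah * dotv g r <= Q * tau.
  have -> : dotv r r - gammah * dotv g r =
      dotv (r - gammah *: g) (r - a) + dotv (r - gammah *: g) a.
    by rewrite -dotvDr subrK dotvDl dotvNl dotvZl.
  by rewrite -[leRHS]add0r lerD.
have ga : gammah * dotv g a' <= gammah * (G * tau).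
  rewrite ler_pM2l//; apply: le_trans (dotv_le_enorm _ _) _.
  by apply: ler_pM; rewrite ?enorm_ge0.
(* Parallelogram inequality, with [tau <= 1]. Multiplied by [gammah * Lf / 2], at most 1/4, it
   consumes half of the decrease |r|^2 supplied by [rg]. *)
have ar : enorm (a' - r) ^+ 2 <= 2 * tau + 2 * enorm r ^+ 2.
  have : enorm a' ^+ 2 <= tau by have := enorm_ge0 a'; nra.
  have := dotv_ge0 (a' + r).
  by rewrite !enorm2 !dotvE (dotvC r a'); lra.
have up : gammah * f (w + (a' - r)) <= gammah *
    (f w + dotv g (a' - r) + Lf / 2 * enorm (a' - r) ^+ 2).
  rewrite ler_pM2l//; have := smooth_upper fL w (w + (a' - r)).
  by rewrite [w + _ - w]addrC addKr.
have gL2 : gammah * Lf * enorm (a' - r) ^+ 2 <= 2^-1 * enorm (a' - r) ^+ 2.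
  by rewrite ler_wpM2r// sqr_ge0.
move: up; rewrite dotvDr dotvNr => up; move: rg; rewrite -enorm2 => rg; lra.
Qed.

(** * Boundedness of the iterates, vanishing inner errors and small residuals *)

Section Convergence.
Context {R : realType} {n : nat}.
Local Notation V := 'rV[R]_n.
Variables (f h : V -> R) (omega : V -> \bar R) (Lf Lh gammah etab : R).
Variables (J : nat -> nat) (B : set V) (xh : nat -> V) (x y : nat -> nat -> V).
Hypotheses (hB : assumptionB f Lf h Lh omega).
Hypotheses (hin : ipr_vfista_input Lf gammah J etab h omega B).
Hypotheses (hrun : ipr_vfista f h omega Lh gammah etab J B xh x y).
Hypothesis Joo : J @ \oo --> \oo.

Let H := hval h omega.
Let S := argmin (hbar h omega).
Let z k := xh k - gammah *: grad f (xh k).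
Let p k := Defs.proj S (z k).
Let eta k := Defs.eta Lh etab (J k).
Let Lh0 := aB_Lh_gt0 hB.
Let etab0 := in_etab hin.

Variable s : V.
Hypothesis Ss : S s.
Let Z M := 3 / 2 * M + gammah * enorm (grad f s).

Lemma near_schedule (P : nat -> Prop) : (\forall j \near \oo, P j) ->
  exists N, forall k, (N <= k)%N -> P (J k).
Proof. by move=> /Joo[N _ NP]; exists N => k Nk; exact: NP. Qed.

Lemma ereal_inf_argmin : ereal_inf (range (hbar h omega)) = (H s)%:E.
Proof.
have E := hbar_edom hB (argmin_edom hB Ss).
apply/le_anti/andP; split; first by apply: ereal_inf_lbound; exists s.
by apply: le_ereal_inf_tmp => _ [u _ <-]; rewrite -E; exact: Ss.
Qed.

Lemma sharp_bounded alpha : bounded_set S ->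
  weakly_sharp (hbar h omega) alpha 2 ->
  exists M N, forall k, (N <= k)%N -> enorm (xh k - s) <= M.
Proof.
move=> Sb [al0 sharp].
have [Ms Ms0 SM] := bounded_enorm s Sb.
have [Mb [Cb [Mb0 Cb0 step]]] := outer_step_bound hB hin hrun Ss.
(* The two terms in [eta] will sum to at most 3/2 eta W^2 with W = 3 d + c0; for eta <= alpha / 54
   this is alpha (W / 6)^2, and W / 6 contributes the contraction d / 2. *)
have a54 : 0 < alpha / 54 by rewrite divr_gt0.
have [N NP] : exists N, forall k, (N <= k)%N ->
    [/\ (1 < J k)%N, eta k <= etab & eta k <= alpha / 54].
  apply: (near_schedule (P := fun j => [/\ (1 < j)%N,
    Defs.eta Lh etab j <= etab & Defs.eta Lh etab j <= alpha / 54])).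
  near=> j; split.
  - by near: j; exists 2%N.
  - by near: j; exact: eta_cvg0.
  - by near: j; exact: eta_cvg0.
pose c0 := Mb + 2 * (gammah * enorm (grad f s)).
pose c1 := Cb / alpha + 1.
pose c2 := c1 + c0 / 6 + Ms.
have [M HM] : exists M, forall k, (N.+1 <= k)%N -> enorm (xh k - s) <= M.
  apply: (@contraction_bounded _ (fun k => enorm (xh k - s)) c2) => -[//|k] Nk.
  have [J1 eb ea] := NP k.+1 (ltnW Nk).
  have e0 : 0 < eta k.+1 := eta_gt0 Lh0 etab0 J1.
  set d := enorm (xh k.+1 - s).
  have stepk : H (xh k.+2) - H s + eta k.+1 / 2 * enorm (xh k.+2 - z k.+1) ^+ 2
    <= eta k.+1 / 2 * enorm (p k.+1 - z k.+1) ^+ 2 + ((J k.+1)%:R ^+ 4)^-1 *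
      (Cb + eta k.+1 * (Mb + 2 * Z d) ^+ 2) := step k d (lexx _) J1 eb.
  have [zp _] : enorm (z k.+1 - p k.+1) <= Z d /\ _ :=
    grad_step_proj_bound hB hin Ss (lexx d).
  have [q sq] :=
    nearest_nonempty (xh k.+2) (argmin_closed hB) (ex_intro _ s Ss).
  have sharpQ : alpha * enorm (xh k.+2 - q) ^+ 2 <= H (xh k.+2) - H s.
    have := sharp (xh k.+2); rewrite (nearest_dist sq) ereal_inf_argmin//.
    by rewrite (hbar_edom hB (run_edom hB hin hrun _)) -EFinB lee_fin.
  have qs := SM q sq.1.
  have xs := ler_enorm_dist q (xh k.+2) s.
  set Q := enorm (xh k.+2 - q) in xs sharpQ.
  have Q0 : 0 <= Q := enorm_ge0 _.
  have W0 : 0 <= 3 * d + c0.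
    rewrite addr_ge0 ?mulr_ge0 ?enorm_ge0// addr_ge0// !mulr_ge0 ?enorm_ge0//.
    exact: ltW (andP (in_gammah hin)).1.
  have WE : Mb + 2 * Z d = 3 * d + c0 by rewrite /Z /c0; field.
  rewrite WE in stepk; move: (3 * d + c0) W0 WE stepk => W W0 WE stepk.
  have J4 : ((J k.+1)%:R ^+ 4)^-1 * (Cb + eta k.+1 * W ^+ 2) <=
      Cb + eta k.+1 * W ^+ 2.
    have CW0 : 0 <= Cb + eta k.+1 * W ^+ 2.
      by apply: addr_ge0 => //; apply: mulr_ge0; [exact: ltW|exact: sqr_ge0].
    rewrite ler_piMl//.
    by rewrite invf_le1 ?exprn_gt0 ?exprn_ege1 ?ler1n ?ltr0n// (ltn_trans _ J1).
  have zpW : eta k.+1 / 2 * enorm (p k.+1 - z k.+1) ^+ 2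
      <= eta k.+1 / 2 * W ^+ 2.
    rewrite ler_wpM2l//; first by rewrite divr_ge0// ltW.
    rewrite ler_pXn2r ?nnegrE ?enorm_ge0// enormB -WE.
    by have := le_trans (enorm_ge0 _) zp; have := zp; lra.
  have eW : eta k.+1 * W ^+ 2 <= alpha / 54 * W ^+ 2.
    by rewrite ler_wpM2r ?sqr_ge0.
  have xz0 : 0 <= eta k.+1 / 2 * enorm (xh k.+2 - z k.+1) ^+ 2.
    by rewrite mulr_ge0 ?sqr_ge0// divr_ge0// ltW.
  have Q2 : Q ^+ 2 <= Cb / alpha + (W / 6) ^+ 2.
    have E : alpha * (Cb / alpha) = Cb by rewrite mulrC divfK ?gt_eqF.
    by rewrite -(ler_pM2l al0) mulrDr E; lra.
  have c10 : 0 <= Cb / alpha by rewrite divr_ge0// ltW.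
  (* The 1 added in [c1] makes its square dominate [Cb / alpha], which avoids a square root. *)
  have Qc : Q <= c1 + W / 6.
    rewrite -(@ler_pXn2r _ 2) ?nnegrE//; last by rewrite /c1; lra.
    by apply: le_trans Q2 _; rewrite /c1; nra.
  by rewrite /c2; move: WE; rewrite /Z /c0; lra.
by exists M, N.+1.
Unshelve. all: by end_near. Qed.

Variables (M : R) (N0 : nat).
Hypothesis xhM : forall k, (N0 <= k)%N -> enorm (xh k - s) <= M.

(** [tikhonov_near] for the sublevel sets [C d] of the objective: [outer_step_bound] controls both
    the excess value and the excess squared distance to [z k]. *)
Lemma inner_error_cvg0 e : 0 < e ->
  exists N, forall k, (N <= k)%N -> enorm (xh k.+1 - p k) <= e.
Proof.
move=> e0.
have M0 : 0 <= M := le_trans (enorm_ge0 _) (xhM (leqnn _)).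
pose C d := [set u | (hbar h omega u <= (H s + d)%:E)%E].
have Ccl d : 0 < d -> closed (C d).
  by move=> _; exact: hbar_sublevel_closed hB _.
have Cmono d d' : d <= d' -> C d `<=` C d'.
  by move=> dd' u /le_trans; apply; rewrite lee_fin lerD2l.
have CS u : (forall d, 0 < d -> C d u) -> S u.
  move=> Cu; apply/(argmin_le hB u Ss)/(hbar_le_edom hB).
  split; first by have /(hbar_le_edom hB)[] := Cu 1 ltr01.
  by apply/ler_addgt0Pr => d d0; have /(hbar_le_edom hB)[] := Cu d d0.
have [dl dl0 tik] := tikhonov_near s M (Z M) Ccl Cmono CS (argmin_convex hB) e0.
have [Mb [Cb [Mb0 Cb0 step]]] := outer_step_bound hB hin hrun Ss.
have g0 : 0 <= gammah * enorm (grad f s).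
  by rewrite mulr_ge0 ?enorm_ge0// ltW// (andP (in_gammah hin)).1.
have Z0 : 0 <= Z M by rewrite addr_ge0// mulr_ge0.
pose K := Cb + etab * (Mb + 2 * Z M) ^+ 2.
have K0 : 0 <= K by rewrite addr_ge0// mulr_ge0 ?sqr_ge0// ltW.
(* If J^-4 <= t eta, the error term is at most eta / 2 * dl, so dividing by eta / 2 leaves an excess
   squared distance of at most [dl]. *)
pose t := dl / (2 * K + 1).
have t0 : 0 < t by rewrite divr_gt0//; lra.
have tK : t * (2 * K) <= dl.
  by rewrite mulrAC ler_pdivrMr; [rewrite ler_pM2l//; lra|lra].
(* If eta <= t', then eta (Z M ^+ 2 + dl) <= dl, which bounds the excess value by [dl]. *)
pose t' := dl / (Z M ^+ 2 + dl).
have t'0 : 0 < t' by rewrite divr_gt0// ltr_wpDl// sqr_ge0.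
have t'K : t' * (Z M ^+ 2 + dl) = dl.
  by rewrite divfK// gt_eqF// ltr_wpDl// sqr_ge0.
have [N NP] : exists N, forall k, (N <= k)%N ->
    [/\ (1 < J k)%N, eta k <= etab, eta k <= t' &
        ((J k)%:R ^+ 4)^-1 <= t * eta k].
  apply: (near_schedule (P := fun j => [/\ (1 < j)%N,
    Defs.eta Lh etab j <= etab, Defs.eta Lh etab j <= t' &
    (j%:R ^+ 4)^-1 <= t * Defs.eta Lh etab j])).
  near=> j; split.
  - by near: j; exists 2%N.
  - by near: j; exact: eta_cvg0.
  - by near: j; exact: eta_cvg0.
  - by near: j; exact: inv4_div_eta_cvg0.
exists (maxn N N0).+1 => -[//|k]; rewrite ltnS geq_max => /andP[Nk N0k].
have [J1 eb et' Jt] := NP k.+1 (leqW Nk).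
have ek : 0 < eta k.+1 := eta_gt0 Lh0 etab0 J1.
have dM := xhM (leqW N0k).
have stepk : H (xh k.+2) - H s + eta k.+1 / 2 * enorm (xh k.+2 - z k.+1) ^+ 2
    <= eta k.+1 / 2 * enorm (p k.+1 - z k.+1) ^+ 2 + ((J k.+1)%:R ^+ 4)^-1 *
      (Cb + eta k.+1 * (Mb + 2 * Z M) ^+ 2) := step k M dM J1 eb.
have [zp _] : enorm (z k.+1 - p k.+1) <= Z M /\ _ :=
    grad_step_proj_bound hB hin Ss dM.
have Dx := run_edom hB hin hrun k.+1.
have Hx : H s <= H (xh k.+2) := hval_argmin hB Ss Dx.
have err : ((J k.+1)%:R ^+ 4)^-1 * (Cb + eta k.+1 * (Mb + 2 * Z M) ^+ 2) <=
    eta k.+1 / 2 * dl.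
  apply: (@le_trans _ _ (t * eta k.+1 * K)).
    apply: ler_pM => //; first by rewrite addr_ge0// mulr_ge0 ?sqr_ge0// ltW.
    by rewrite lerD2l ler_wpM2r// sqr_ge0.
  have -> : t * eta k.+1 * K = eta k.+1 / 2 * (t * (2 * K)) by field.
  by rewrite ler_wpM2l// divr_ge0// ltW.
have pz : enorm (p k.+1 - z k.+1) ^+ 2 <= Z M ^+ 2.
  by rewrite ler_pXn2r ?nnegrE ?enorm_ge0// enormB.
apply: (tik _ (z k.+1)) => //.
- apply/(hbar_le_edom hB); split=> //.
  have h1 : eta k.+1 / 2 * enorm (p k.+1 - z k.+1) ^+ 2
      <= eta k.+1 / 2 * Z M ^+ 2.
    by rewrite ler_wpM2l// divr_ge0// ltW.
  have h2 : eta k.+1 * (Z M ^+ 2 + dl) <= dl.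
    by rewrite -[leRHS]t'K ler_wpM2r// addr_ge0 ?sqr_ge0// ltW.
  have h3 : 0 <= eta k.+1 / 2 * enorm (xh k.+2 - z k.+1) ^+ 2.
    by rewrite mulr_ge0 ?sqr_ge0// divr_ge0// ltW.
  by rewrite -/(H _); lra.
- exact: xhM (leqW (leqW N0k)).
- exact: nearest_target hB _.
- rewrite -(ler_pM2l (_ : 0 < eta k.+1 / 2)); last by rewrite divr_gt0.
  by rewrite mulrDr; lra.
Unshelve. all: by end_near. Qed.

Lemma residual_small N e : 0 < e ->
  exists2 k, (N <= k)%N & enorm (residual gammah f S (xh k)) <= e.
Proof.
move=> e0; apply: contrapT => Hres.
have decr (a b c d : R) : c < b -> d <= c / 4 -> a - 2^-1 * b + d <= a - c / 4.
  by lra.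
have {}Hres k : (N <= k)%N -> e < enorm (residual gammah f S (xh k)).
  by move=> Nk; rewrite ltNge; apply/negP => le; apply: Hres; exists k.
have [g0 _] := andP (in_gammah hin).
have Lf0 := aB_Lf_gt0 hB.
have gL := gammah_Lf_le hB hin.
pose G := enorm (grad f s) + Lf * M.
pose Q := Z M.
have M0 : 0 <= M := le_trans (enorm_ge0 _) (xhM (leqnn _)).
have G0 : 0 <= G by rewrite addr_ge0 ?enorm_ge0// mulr_ge0// ltW.
have Q0 : 0 <= Q.
  by rewrite addr_ge0// mulr_ge0 ?enorm_ge0// ltW.
pose b := gammah * G + Q + 1.
have b0 : 0 < b by rewrite ltr_wpDl// addr_ge0// mulr_ge0// ltW.
(* The error [tau * b] is at most half of the decrease (gammah e)^2 / 2 that a residual above [e]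
   would force. *)
pose tau := Num.min 1 ((gammah * e) ^+ 2 / 4 / b).
have ge0 : 0 < gammah * e by rewrite mulr_gt0.
have tau0 : 0 < tau by rewrite lt_min ltr01 !divr_gt0// exprn_gt0.
have tau1 : tau <= 1 by rewrite ge_min lexx.
have taub : tau * b <= (gammah * e) ^+ 2 / 4.
  by rewrite -ler_pdivlMr// ge_min lexx orbT.
have [N1 err] := inner_error_cvg0 tau0.
have [l fl] : exists l, forall u, l <= f u.
  have := aB_f_bounded_below hB; case E : (ereal_inf _) => [l| |] // _.
    by exists l => u; rewrite -lee_fin -E; apply: ereal_inf_lbound; exists u.
  have : (ereal_inf (range (EFin \o f)) <= (f s)%:E)%E.
    by apply: ereal_inf_lbound; exists s.
  by rewrite E.
pose c := (gammah * e) ^+ 2 / 4 / gammah.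
have c0 : 0 < c by rewrite !divr_gt0// exprn_gt0.
apply: (@no_uniform_descent R (fun k => f (xh k)) l c
  (maxn N (maxn N0 N1)).+1) => //.
move=> [//|k]; rewrite ltnS !geq_max => /and3P[Nk N0k N1k].
set w := xh k.+1; set g := grad f w.
set r := w - p k.+1; set a := w - p k; set a' := xh k.+2 - p k.+1.
have dM : enorm (xh k.+1 - s) <= M := xhM (leqW N0k).
have [zp _] : enorm (z k.+1 - p k.+1) <= Q /\ _ :=
    grad_step_proj_bound hB hin Ss dM.
have aE : enorm a <= tau := err k N1k.
have aE' : enorm a' <= tau := err k.+1 (leqW N1k).
have gG : enorm g <= G.
  have gs := le_trans ((aB_f_smooth hB).2 w s) (ler_wpM2l (ltW Lf0) dM).
  have := ler_enormD (g - grad f s) (grad f s); rewrite subrK.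
  by move/le_trans; apply; rewrite addrC lerD2l.
have re : (gammah * e) ^+ 2 < enorm r ^+ 2.
  rewrite ltr_pXn2r ?nnegrE ?enorm_ge0//; last exact: ltW.
  have := Hres k.+1 (leqW Nk).
  rewrite /residual -/(z k.+1) -/(p k.+1) -/w -/r enormZ gtr0_norm ?invr_gt0//.
  by rewrite ltr_pdivlMl.
have zr : z k.+1 - p k.+1 = r - gammah *: g by rewrite /z /r [LHS]addrAC.
have ra : p k - p k.+1 = r - a by rewrite /r /a opprB [RHS]addrC subrKA.
(* [w] itself may lie outside [S], so the variational inequality at [p k.+1] is tested at [p k],
   which is in [S] and within [tau] of [w]. *)
have vi : dotv (r - gammah *: g) (r - a) <= 0.
  have np j : nearest S (z j) (p j) by exact: nearest_target hB _.
  have := nearest_obtuse (argmin_convex hB) (np k.+1) (np k).1.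
  by rewrite zr ra.
have wE : xh k.+2 = w + (a' - r).
  by rewrite /a' /r opprB subrKA [RHS]addrC subrK.
have gb := inexact_projected_step (aB_f_smooth hB) g0 gL tau0 tau1 gG
  (eq_ind _ (fun v => enorm v <= Q) zp _ zr) aE aE' vi.
rewrite -wE in gb.
have gc : gammah * c = (gammah * e) ^+ 2 / 4.
  by rewrite /c mulrC divfK// gt_eqF.
by rewrite -(ler_pM2l g0) mulrBr gc; apply: (le_trans gb); exact: decr.
Qed.

End Convergence.

(** * Growth of the power schedule and assembly of the two cases *)

Lemma ceil_powR_cvgn (R : realType) (a : R) (J : nat -> nat) : 1 <= a ->
  (forall k, (J k)%:Z = Num.ceil (k.+1%:R `^ a)) -> J @ \oo --> \oo.
Proof.
move=> a1 JE.
have kJ k : (k < J k)%N.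
  rewrite -ltz_nat JE -(ltr_int R).
  apply: (lt_le_trans _ (ceil_ge _)).
  apply: (@lt_le_trans _ _ k.+1%:R); first by rewrite ltr_nat.
  by rewrite -[leLHS]powRr1// ler_powR// ler1n.
move=> P [N _ NP]; exists N => // k /= Nk; apply: NP => /=.
exact: leq_trans Nk (ltnW (kJ k)).
Qed.

Theorem theorem3 (R : realType) (n : nat)
  (f h : 'rV[R]_n -> R) (omega : 'rV[R]_n -> \bar R) (Lf Lh : R)
  (gammah etab : R) (J : nat -> nat) (B : set 'rV[R]_n)
  (xh : nat -> 'rV[R]_n) (x y : nat -> nat -> 'rV[R]_n)
  (hB : assumptionB f Lf h Lh omega)
  (hin : ipr_vfista_input Lf gammah J etab h omega B)
  (hrun : ipr_vfista f h omega Lh gammah etab J B xh x y)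
  (hcase :
    (exists X : set 'rV[R]_n,
       [/\ X !=set0, compact X, convex_set X, omega = eindic X
         & J @ \oo --> \oo])
    \/
    (exists alpha a : R,
       [/\ bounded_set (argmin (hbar h omega)),
           weakly_sharp (hbar h omega) alpha 2,
           2 <= a
         & forall k, (J k)%:Z = Num.ceil (k.+1%:R `^ a)])) :
  limn_einf
    (fun k => (enorm (residual gammah f (argmin (hbar h omega)) (xh k)))%:E)
  = 0%E.
Proof.
have [s Ss] := aB_argmin_nonempty hB.
(* Both cases are used only through [J] tending to infinity and a bound on a tail of the
   iterates. *)
have [Joo [M [N xhM]]] : J @ \oo --> \oo /\ exists M N, forall k, (N <= k)%N ->
    enorm (xh k - s) <= M.
  case: hcase => [[X [_ Xc _ omegaX Joo]]|[alpha [a [Sb sharp a2 JE]]]].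
    split=> //; have [M _ XM] := bounded_enorm s (compact_bounded Xc).
    (* The tail starts at 1: [xh 0] is arbitrary and may lie outside [X]. *)
    exists M, 1%N => -[//|k] _; apply: XM.
    have := run_edom hB hin hrun k.
    by rewrite /edom /= omegaX /eindic; case: asboolP.
  have Joo : J @ \oo --> \oo.
    by apply: ceil_powR_cvgn JE; apply: le_trans a2; rewrite ler1n.
  by split=> //; exact: (sharp_bounded hB hin hrun Joo Ss Sb sharp).
apply: limn_einf_eq0 => [k|K e e0]; first exact: enorm_ge0.
exact: (residual_small hB hin hrun Joo Ss xhM).
Qed.
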